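(* Let $\chi_1,\chi_2,\chi_3$ be signed permutation matrices, at least two of which are symmetric. Then the signed patterns $$\begin{pmatrix}\chi_1&0&0\\0&\chi_2&0\\0&0&\chi_3\end{pmatrix}\quad\text{and}\quad\begin{pmatrix}\chi_1&0&0\\0&-\chi_2&0\\0&0&\chi_3\end{pmatrix}$$ are I-Wilf equivalent.
   Context: A signed permutation matrix of size $n$ is an $n\times n$ matrix with entries in $\{0,1,-1\}$ having exactly one nonzero entry in every row and every column; $B_n$ is the set of these. $SI_n$ is the set of involutions in $B_n$, i.e. the symmetric signed permutation matrices of size $n$. An element $\pi\in B_n$ contains a signed permutation matrix $\tau$ if $\tau$ is a submatrix of $\pi$ (rows and columns kept in order); otherwise $\pi$ avoids $\tau$. $SI_n(\tau)$ is the set of elements of $SI_n$ avoiding $\tau$. Two signed patterns $\sigma,\tau$ are I-Wilf equivalent, $\sigma\stackrel{I}{\sim}\tau$, if $|SI_n(\sigma)|=|SI_n(\tau)|$ for every $n\ge1$. *)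

(* Defs.v *)
From HB Require Import structures.
From mathcomp Require Import all_boot all_order all_algebra.

Set Implicit Arguments.
Unset Strict Implicit.
Unset Printing Implicit Defensive.

Import GRing.Theory.
Local Open Scope ring_scope.

Definition signed_perm_mx n (A : 'M[int]_n) : bool :=
  [&& [forall i, forall j, A i j \in [:: 0; 1; -1]],
      [forall i, #|[set j | A i j != 0]| == 1%N]
    & [forall j, #|[set i | A i j != 0]| == 1%N]].

Record sperm n := SPerm {
  sperm_mx :> 'M[int]_n;
  sperm_mxP : signed_perm_mx sperm_mx
}.

HB.instance Definition _ n := [isSub for @sperm_mx n].
HB.instance Definition _ n := [Countable of sperm n by <:].

(* 'M[int]_n is not finite, so finiteness of sperm n is obtained by shifting
   the entries by 1 and reading them in 'I_3. *)
Definition sperm_code n (A : sperm n) : 'M['I_3]_n :=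
  map_mx (fun z : int => inord (absz (z + 1))) A.

Definition sperm_decode n (M : 'M['I_3]_n) : option (sperm n) :=
  insub (map_mx (fun k : 'I_3 => (k : nat)%:Z - 1) M).

Lemma sperm_codeK n : pcancel (@sperm_code n) (@sperm_decode n).
Proof.
move=> A; rewrite /sperm_decode.
have -> : map_mx (fun k : 'I_3 => (k : nat)%:Z - 1) (sperm_code A) = val A.
  apply/matrixP => i j; rewrite !mxE /=.
  have /and3P[/forallP/(_ i)/forallP/(_ j) + _ _] := sperm_mxP A.
  by rewrite !inE => /or3P[] /eqP ->; rewrite inordK.
exact: valK.
Qed.

HB.instance Definition _ n : isFinite (sperm n) :=
  PCanIsFinite (@sperm_codeK n).

Definition strictly_increasing k n (f : {ffun 'I_k -> 'I_n}) : bool :=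
  [forall i : 'I_k, forall j : 'I_k, (i < j)%N ==> (f i < f j)%N].

(* The rows and the columns of the submatrix are chosen independently, each in
   increasing order. *)
Definition contains n k (A : 'M[int]_n) (tau : 'M[int]_k) : bool :=
  [exists f : {ffun 'I_k -> 'I_n}, exists g : {ffun 'I_k -> 'I_n},
    [&& strictly_increasing f, strictly_increasing g & mxsub f g A == tau]].

Definition avoids n k (A : 'M[int]_n) (tau : 'M[int]_k) : bool :=
  ~~ contains A tau.

Definition symmetric_mx n (A : 'M[int]_n) : bool := A^T == A.

(* Involutions of B_n; see signed_perm_involutionE for A *m A = 1%:M. *)
Definition SI n : {set sperm n} := [set A : sperm n | symmetric_mx A].

Definition SI_avoid n k (tau : 'M[int]_k) : {set sperm n} :=
  [set A in SI n | avoids A tau].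

Definition I_Wilf_equiv k l (sigma : 'M[int]_k) (tau : 'M[int]_l) : Prop :=
  forall n : nat, (1 <= n)%N -> #|SI_avoid n sigma| = #|SI_avoid n tau|.

Definition block_diag3 n1 n2 n3
    (A : 'M[int]_n1) (B : 'M[int]_n2) (C : 'M[int]_n3) :
    'M[int]_(n1 + (n2 + n3)) :=
  block_mx A 0 0 (block_mx B 0 0 C).

Lemma signed_perm_mul_tr n (A : 'M[int]_n) :
  signed_perm_mx A -> A *m A^T = 1%:M.
Proof.
case/and3P=> /forallP A01 /forallP Ar /forallP Ac; apply/matrixP => i k.
rewrite !mxE.
have /cards1P[j0 Ej0] := Ar i.
have Aij j : (A i j != 0) = (j == j0) by rewrite -in_set1 -Ej0 inE.
rewrite (bigD1 j0) //= big1 ?addr0 => [|j]; last first.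
  by rewrite -Aij negbK mxE => /eqP->; rewrite mul0r.
rewrite mxE; have [<-|neq_ik] := eqVneq i k.
  have := Aij j0; rewrite eqxx; have /forallP/(_ j0) := A01 i.
  by rewrite !inE => /or3P[] /eqP ->.
have /cards1P[i0 Ei0] := Ac j0.
have Akj m : (A m j0 != 0) = (m == i0) by rewrite -in_set1 -Ei0 inE.
have := Akj i; rewrite Aij eqxx => /esym/eqP Ei.
have := Akj k; rewrite -Ei [k == i]eq_sym (negPf neq_ik) => /negbFE/eqP->.
by rewrite mulr0.
Qed.

Lemma signed_perm_involutionE n (A : sperm n) :
  (A \in SI n) = (A *m A == 1%:M).
Proof.
have AAt := signed_perm_mul_tr (sperm_mxP A).
rewrite inE /symmetric_mx; apply/eqP/eqP => [{2}<- //|AA].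
by rewrite -[LHS]mul1mx -AA -mulmxA AAt mulmx1.
Qed.

(* Main.v *)
Require Import Defs.
From mathcomp Require Import all_boot all_order all_algebra.
Local Open Scope ring_scope.

(** Writing [D(X, Y, Z)] for the block diagonal matrix with blocks [X], [Y],
    [Z], the equivalence is realised by one explicit sign-changing involution
    on signed permutation matrices.

    Given [A], call a cell [(i, j)] active if some occurrence of [chi1] or of
    its transpose lies strictly north-west of it, and some occurrence of [chi3]
    or of its transpose lies strictly south-east of it.  The involution
    [flip_mx] negates the entries of [A] in all active cells.

    - Active cells do not move ([dominated_agree]): the cells having an
      occurrence to their north-west form a set closed under moving south-east,
      and any such cell already has an occurrence to its north-west none of
      whose cells is in the set, hence one that the flip leaves intact.  So
      flipping twice is the identity.  As patterns are taken up to
      transposition, the active cells of a symmetric matrix form a symmetric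
      set, and the flip preserves symmetry.

    - In a signed permutation matrix, occurrences of the three blocks that are
      placed from north-west to south-east form an occurrence of the block
      diagonal pattern, the off-diagonal blocks being forced to vanish
      ([occ_block]).  Hence [A] contains some [D(X, Y, Z)] with [X], [Y], [Z]
      equal to [chi1], [chi2], [chi3] up to transposition if and only if some
      occurrence of [chi2] or its transpose has all of its cells, zero entries
      included, active, at least when [chi2] is not empty ([contains_uptoP]).
      The flip negates this occurrence, so it exchanges [chi2] with [- chi2].

    - When two of the three blocks are symmetric, the patterns [D(X, Y, Z)] so
      obtained are [D(chi1, chi2, chi3)] and its transpose, and a symmetric
      matrix contains both or neither ([contains_uptoE]). *)

Set Implicit Arguments.
Unset Strict Implicit.
Unset Printing Implicit Defensive.

Import GRing.Theory.

(** * Transposes and opposites of signed permutation matrices *)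

Lemma signed_perm_mx_tr n (A : 'M[int]_n) :
  signed_perm_mx A -> signed_perm_mx A^T.
Proof.
case/and3P=> /forallP A01 /forallP Ar /forallP Ac; apply/and3P; split.
- by apply/forallP=> i; apply/forallP=> j; rewrite mxE; move/forallP: (A01 j).
- apply/forallP=> i; rewrite -(eqP (Ac i)); apply/eqP/eq_card => j.
  by rewrite !inE mxE.
- apply/forallP=> j; rewrite -(eqP (Ar j)); apply/eqP/eq_card => i.
  by rewrite !inE mxE.
Qed.

Lemma signed_perm_mx_sign n (A B : 'M[int]_n) :
    (forall i j, B i j = A i j \/ B i j = - A i j) ->
  signed_perm_mx A -> signed_perm_mx B.
Proof.
move=> AB.
have nz i j : (B i j != 0) = (A i j != 0).
  by case: (AB i j) => ->; rewrite ?oppr_eq0.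
case/and3P=> /forallP A01 /forallP Ar /forallP Ac; apply/and3P; split.
- apply/forallP=> i; apply/forallP=> j; have /forallP/(_ j) := A01 i.
  by rewrite !inE; case: (AB i j) => -> // /or3P[] /eqP->.
- apply/forallP=> i; rewrite -(eqP (Ar i)); apply/eqP/eq_card => j.
  by rewrite !inE nz.
- apply/forallP=> j; rewrite -(eqP (Ac j)); apply/eqP/eq_card => i.
  by rewrite !inE nz.
Qed.

Lemma signed_perm_mxN n (A : 'M[int]_n) :
  signed_perm_mx A -> signed_perm_mx (- A).
Proof. by apply: signed_perm_mx_sign => i j; rewrite mxE; right. Qed.

Lemma signed_perm_row_neq0 n (A : 'M[int]_n) i :
  signed_perm_mx A -> exists j, A i j != 0.
Proof.
case/and3P=> _ /forallP/(_ i)/cards1P[j Ej] _; exists j.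
by have := set11 j; rewrite -Ej inE.
Qed.

Lemma signed_perm_row_uniq n (A : 'M[int]_n) i j k :
  signed_perm_mx A -> A i j != 0 -> j != k -> A i k = 0.
Proof.
case/and3P=> _ /forallP/(_ i)/cards1P[l El] _ Aij; apply: contraNeq => Aik.
have : j \in [set l] by rewrite -El inE.
have : k \in [set l] by rewrite -El inE.
by rewrite !inE => /eqP-> /eqP->.
Qed.

Definition trb n (e : bool) (X : 'M[int]_n) : 'M[int]_n := if e then X^T else X.

Lemma signed_perm_trb n e (X : 'M[int]_n) :
  signed_perm_mx X -> signed_perm_mx (trb e X).
Proof. by case: e => //; apply: signed_perm_mx_tr. Qed.

Lemma trbN n e (X : 'M[int]_n) : trb e (- X) = - trb e X.
Proof. by case: e => //=; rewrite linearN. Qed.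

Lemma trb_tr n e (X : 'M[int]_n) : (trb e X)^T = trb (~~ e) X.
Proof. by case: e => //=; rewrite trmxK. Qed.

Lemma trb_sym n e (X : 'M[int]_n) : symmetric_mx X -> trb e X = X.
Proof. by case: e => //= /eqP. Qed.

(** * Occurrences of patterns *)

Lemma strictly_increasingP k n (f : {ffun 'I_k -> 'I_n}) :
  reflect {homo f : i j / (i < j)%N} (strictly_increasing f).
Proof.
apply: (iffP forallP) => [fi i j ij | fi i].
  by have /forallP/(_ j)/implyP/(_ ij) := fi i.
by apply/forallP=> j; apply/implyP/fi.
Qed.

Lemma strictly_increasing_le k n (f : {ffun 'I_k -> 'I_n}) (i j : 'I_k) :
  strictly_increasing f -> (i <= j)%N -> (f i <= f j)%N.
Proof.
move/strictly_increasingP=> fi; rewrite leq_eqVlt => /predU1P[/val_inj-> //|].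
by move/fi/ltnW.
Qed.

Definition occ n k (A : 'M[int]_n) (P : 'M[int]_k) (f g : {ffun 'I_k -> 'I_n}) :=
  [&& strictly_increasing f, strictly_increasing g & mxsub f g A == P].

Lemma containsP n k (A : 'M[int]_n) (P : 'M[int]_k) :
  reflect (exists f g, occ A P f g) (contains A P).
Proof.
apply: (iffP existsP) => [[f /existsP[g H]] | [f [g H]]]; first by exists f, g.
by exists f; apply/existsP; exists g.
Qed.

Lemma occE n k (A : 'M[int]_n) (P : 'M[int]_k) f g a b :
  occ A P f g -> A (f a) (g b) = P a b.
Proof. by case/and3P=> _ _ /eqP <-; rewrite mxE. Qed.

Lemma occ_eq n k (A B : 'M[int]_n) (P Q : 'M[int]_k)
    (f g : {ffun 'I_k -> 'I_n}) :
    (forall a b, A (f a) (g b) = P a b -> B (f a) (g b) = Q a b) ->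
  occ A P f g -> occ B Q f g.
Proof.
move=> eqAB /and3P[fi gi /eqP/matrixP AP]; apply/and3P; split=> //.
by apply/eqP/matrixP=> a b; rewrite mxE; apply: eqAB; rewrite -AP mxE.
Qed.

Lemma occ_tr n k (A : 'M[int]_n) (P : 'M[int]_k) f g :
  occ A P f g -> occ A^T P^T g f.
Proof.
by case/and3P=> fi gi /eqP <-; apply/and3P; split=> //; rewrite trmx_mxsub.
Qed.

Lemma contains_tr n k (A : 'M[int]_n) (P : 'M[int]_k) :
  contains A^T P^T = contains A P.
Proof.
by apply/containsP/containsP=> -[f [g /occ_tr]]; rewrite ?trmxK; exists g, f.
Qed.

Definition cat_ffun p q n (f : {ffun 'I_p -> 'I_n}) (g : {ffun 'I_q -> 'I_n}) :
  {ffun 'I_(p + q) -> 'I_n} :=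
  [ffun x => match split x with inl a => f a | inr b => g b end].

Lemma cat_ffunl p q n (f : {ffun 'I_p -> 'I_n}) (g : {ffun 'I_q -> 'I_n}) a :
  cat_ffun f g (lshift q a) = f a.
Proof.
by rewrite ffunE; case: split_ordP => b /eqP; rewrite eq_shift // => /eqP->.
Qed.

Lemma cat_ffunr p q n (f : {ffun 'I_p -> 'I_n}) (g : {ffun 'I_q -> 'I_n}) b :
  cat_ffun f g (rshift p b) = g b.
Proof.
by rewrite ffunE; case: split_ordP => a /eqP; rewrite eq_shift // => /eqP->.
Qed.

Lemma cat_ffun_inc p q n (f : {ffun 'I_p -> 'I_n}) (g : {ffun 'I_q -> 'I_n}) :
    strictly_increasing f -> strictly_increasing g ->
    (forall a b, (f a < g b)%N) ->
  strictly_increasing (cat_ffun f g).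
Proof.
move=> /strictly_increasingP fi /strictly_increasingP gi fg.
apply/strictly_increasingP=> x y.
case: (split_ordP x) => a ->; case: (split_ordP y) => b ->;
  rewrite ?cat_ffunl ?cat_ffunr //=.
- exact: fi.
- by rewrite ltnNge (leq_trans (ltnW (ltn_ord b))) ?leq_addr.
- by rewrite ltn_add2l; apply: gi.
Qed.

(** A row of [A] meeting an occurrence of a signed permutation matrix has its
    only nonzero entry inside that occurrence, so it vanishes on the columns
    of the other block. *)
Lemma occ_block n p q (A : 'M[int]_n) (X : 'M[int]_p) (Y : 'M[int]_q) f1 g1 f2 g2 :
    signed_perm_mx A -> (forall i, exists j, X i j != 0) ->
    (forall i, exists j, Y i j != 0) ->
    occ A X f1 g1 -> occ A Y f2 g2 ->
    (forall a b, (f1 a < f2 b)%N) -> (forall a b, (g1 a < g2 b)%N) ->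
  occ A (block_mx X 0 0 Y) (cat_ffun f1 f2) (cat_ffun g1 g2).
Proof.
move=> hA hX hY o1 o2 f12 g12.
have /and3P[f1i g1i _] := o1; have /and3P[f2i g2i _] := o2.
apply/and3P; split; try exact: cat_ffun_inc.
apply/eqP/matrixP=> x y; rewrite mxE.
case: (split_ordP x) => a ->; case: (split_ordP y) => b ->;
  rewrite ?cat_ffunl ?cat_ffunr ?block_mxEul ?block_mxEur ?block_mxEdl ?block_mxEdr.
- exact: occE o1.
- have [c] := hX a; rewrite -(occE _ _ o1) mxE => /(signed_perm_row_uniq hA).
  by apply; rewrite neq_ltn g12.
- have [c] := hY a; rewrite -(occE _ _ o2) mxE => /(signed_perm_row_uniq hA).
  by apply; rewrite neq_ltn g12 orbT.
- exact: occE o2.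
Qed.

Definition lpart p q n (f : {ffun 'I_(p + q) -> 'I_n}) : {ffun 'I_p -> 'I_n} :=
  [ffun a => f (lshift q a)].

Definition rpart p q n (f : {ffun 'I_(p + q) -> 'I_n}) : {ffun 'I_q -> 'I_n} :=
  [ffun b => f (rshift p b)].

Lemma lpart_inc p q n (f : {ffun 'I_(p + q) -> 'I_n}) :
  strictly_increasing f -> strictly_increasing (lpart f).
Proof.
move/strictly_increasingP=> fi; apply/strictly_increasingP=> a b ab.
by rewrite !ffunE fi.
Qed.

Lemma rpart_inc p q n (f : {ffun 'I_(p + q) -> 'I_n}) :
  strictly_increasing f -> strictly_increasing (rpart f).
Proof.
move/strictly_increasingP=> fi; apply/strictly_increasingP=> a b ab.
by rewrite !ffunE fi //= ltn_add2l.
Qed.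

Lemma lpart_lt_rpart p q n (f : {ffun 'I_(p + q) -> 'I_n}) a b :
  strictly_increasing f -> (lpart f a < rpart f b)%N.
Proof.
by move/strictly_increasingP=> fi; rewrite !ffunE fi //= ltn_addr.
Qed.

Lemma occ_block_inv n p q (A : 'M[int]_n) (X : 'M[int]_p) (Y : 'M[int]_q) f g :
    occ A (block_mx X 0 0 Y) f g ->
  occ A X (lpart f) (lpart g) /\ occ A Y (rpart f) (rpart g).
Proof.
move=> o; have /and3P[fi gi _] := o.
split; apply/and3P; split; rewrite ?lpart_inc ?rpart_inc //.
  by apply/eqP/matrixP=> a b; rewrite mxE !ffunE (occE _ _ o) block_mxEul.
by apply/eqP/matrixP=> a b; rewrite mxE !ffunE (occE _ _ o) block_mxEdr.
Qed.

Lemma block_rows_neq0 p q (X : 'M[int]_p) (Y : 'M[int]_q) :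
    (forall i, exists j, X i j != 0) -> (forall i, exists j, Y i j != 0) ->
  forall i, exists j, block_mx X 0 0 Y i j != 0.
Proof.
move=> hX hY i; case: (split_ordP i) => a ->.
  by have [b] := hX a; exists (lshift q b); rewrite block_mxEul.
by have [b] := hY a; exists (rshift p b); rewrite block_mxEdr.
Qed.

(** * Cells dominated by an occurrence *)

(** The relation [r] stands for one of the two strict orders on indices, so
    that north-west and south-east are treated at once; the pattern is taken up
    to transposition, so that a symmetric [A] has a symmetric region. *)
Definition dominated n k (r : rel 'I_n) (X : 'M[int]_k) (A : 'M[int]_n) i j :=
  [exists f : {ffun 'I_k -> 'I_n}, exists g : {ffun 'I_k -> 'I_n},
   exists e : bool,
    [&& occ A (trb e X) f g, [forall a, r (f a) i] & [forall b, r (g b) j]]].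

Lemma dominatedP n k (r : rel 'I_n) (X : 'M[int]_k) A i j :
  reflect (exists f g e, [/\ occ A (trb e X) f g,
              forall a, r (f a) i & forall b, r (g b) j])
          (dominated r X A i j).
Proof.
apply: (iffP existsP) => [[f /existsP[g /existsP[e]]] | [f [g [e []]]]].
  by case/and3P=> o /forallP fr /forallP gr; exists f, g, e.
move=> o fr gr; exists f; apply/existsP; exists g; apply/existsP; exists e.
by apply/and3P; split=> //; apply/forallP.
Qed.

Lemma dominated_trans n k (r : rel 'I_n) (X : 'M[int]_k) A i j i' j' :
  transitive r -> r i i' -> r j j' ->
  dominated r X A i j -> dominated r X A i' j'.
Proof.
move=> rT ri rj /dominatedP[f [g [e [o fr gr]]]].
apply/dominatedP; exists f, g, e; split=> // a.
  exact: rT (fr a) ri.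
exact: rT (gr a) rj.
Qed.

Lemma dominated_tr n k (r : rel 'I_n) (X : 'M[int]_k) A i j :
  dominated r X A i j -> dominated r X A^T j i.
Proof.
move/dominatedP=> [f [g [e [/occ_tr o fr gr]]]]; apply/dominatedP.
by exists g, f, (~~ e); rewrite -trb_tr.
Qed.

Lemma dominated_sym n k (r : rel 'I_n) (X : 'M[int]_k) A i j :
  symmetric_mx A -> dominated r X A i j = dominated r X A j i.
Proof.
by move=> /eqP sA; apply/idP/idP => /dominated_tr; rewrite sA.
Qed.

(** An occurrence that dominates a cell and has itself a cell in the dominated
    region can be replaced by one that dominates the latter cell.  As [r] is
    well founded on a finite type, this ends with an occurrence avoiding the
    region, on which [A] and [B] agree. *)
Lemma dominated_agree n k (r : rel 'I_n) (X : 'M[int]_k) (A B : 'M[int]_n) :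
    transitive r -> irreflexive r ->
    (forall i j, ~~ dominated r X A i j -> B i j = A i j) ->
  dominated r X B =2 dominated r X A.
Proof.
move=> rT rI AB i j; apply/idP/idP.
  move=> /dominatedP[f [g [e [o fr gr]]]].
  have [/existsP[a /existsP[b ab]] | out] :=
    boolP [exists a, exists b, dominated r X A (f a) (g b)].
    exact: dominated_trans (fr a) (gr b) ab.
  apply/dominatedP; exists f, g, e; split=> //; apply: occ_eq o => a b <-.
  rewrite AB //; apply: contra out => ab.
  by apply/existsP; exists a; apply/existsP; exists b.
have [m] := ubnP #|[pred x | r x i]|; elim: m i j => // m IHm i j /ltnSE le_m.
move=> /dominatedP[f [g [e [o fr gr]]]].
have [/existsP[a /existsP[b ab]] | out] :=
  boolP [exists a, exists b, dominated r X A (f a) (g b)].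
  apply: dominated_trans (fr a) (gr b) _ => //; apply: IHm ab.
  apply: leq_trans le_m; apply/proper_card/properP; split.
    by apply/subsetP=> x; rewrite !inE => /rT; apply; apply: fr.
  by exists (f a); rewrite !inE ?fr // rI.
apply/dominatedP; exists f, g, e; split=> //; apply: occ_eq o => a b <-.
rewrite AB //; apply: contra out => ab.
by apply/existsP; exists a; apply/existsP; exists b.
Qed.

(** * The sign-changing involution *)

Definition before n : rel 'I_n := fun i j => (i < j)%N.
Definition after n : rel 'I_n := fun i j => (j < i)%N.
Arguments before {n}.
Arguments after {n}.

Lemma before_trans n : transitive (@before n).
Proof. by move=> j i k; apply: ltn_trans. Qed.

Lemma after_trans n : transitive (@after n).
Proof. by move=> j i k ij jk; apply: ltn_trans jk ij. Qed.

Lemma before_irr n : irreflexive (@before n).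
Proof. by move=> i; apply: ltnn. Qed.

Lemma after_irr n : irreflexive (@after n).
Proof. by move=> i; apply: ltnn. Qed.

Section Flip.

Variables (n n1 n3 : nat) (X : 'M[int]_n1) (Z : 'M[int]_n3).
Implicit Type A : 'M[int]_n.

Definition active A i j := dominated before X A i j && dominated after Z A i j.

Definition flip_mx A : 'M[int]_n :=
  \matrix_(i, j) if active A i j then - A i j else A i j.

Lemma active_flip A : active (flip_mx A) =2 active A.
Proof.
move=> i j; rewrite /active; congr (_ && _); apply: dominated_agree.
- exact: before_trans.
- exact: before_irr.
- by move=> a b /negPf out; rewrite mxE /active out.
- exact: after_trans.
- exact: after_irr.
- by move=> a b /negPf out; rewrite mxE /active out andbF.
Qed.

Lemma flip_mxK : involutive flip_mx.
Proof.
move=> A; apply/matrixP=> i j; rewrite mxE active_flip mxE.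
by case: (active A i j); rewrite ?opprK.
Qed.

Lemma flip_mx_signed_perm A : signed_perm_mx A -> signed_perm_mx (flip_mx A).
Proof.
by apply: signed_perm_mx_sign => i j; rewrite mxE; case: ifP; [right | left].
Qed.

Lemma flip_mx_sym A : symmetric_mx A -> symmetric_mx (flip_mx A).
Proof.
move=> sA; apply/eqP/matrixP=> i j; rewrite !mxE /active.
rewrite !(dominated_sym _ _ j) //.
by have /eqP/matrixP/(_ i j) := sA; rewrite mxE => ->.
Qed.

Definition flip_sperm (A : sperm n) : sperm n :=
  SPerm (flip_mx_signed_perm (sperm_mxP A)).

Lemma flip_spermK : involutive flip_sperm.
Proof. by move=> A; apply/val_inj/flip_mxK. Qed.

Lemma flip_sperm_SI (A : sperm n) : (flip_sperm A \in SI n) = (A \in SI n).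
Proof.
rewrite !inE; apply/idP/idP => /flip_mx_sym //.
by rewrite /= flip_mxK.
Qed.

End Flip.

(** * Block diagonal patterns up to transposition of the blocks *)

Definition contains_upto n n1 n2 n3 (A : 'M[int]_n)
    (X : 'M[int]_n1) (Y : 'M[int]_n2) (Z : 'M[int]_n3) : Prop :=
  exists e1 e2 e3,
    contains A (block_diag3 (trb e1 X) (trb e2 Y) (trb e3 Z)).

Lemma tr_block_diag3 n1 n2 n3
    (X : 'M[int]_n1) (Y : 'M[int]_n2) (Z : 'M[int]_n3) :
  (block_diag3 X Y Z)^T = block_diag3 X^T Y^T Z^T.
Proof. by rewrite /block_diag3 !tr_block_mx !trmx0. Qed.

(** Of the eight choices of transposes, those that transpose the possibly
    non-symmetric block give the transposed pattern, the others the pattern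
    itself. *)
Lemma contains_uptoE n n1 n2 n3 (A : 'M[int]_n)
    (X : 'M[int]_n1) (Y : 'M[int]_n2) (Z : 'M[int]_n3) :
    symmetric_mx A ->
    [\/ symmetric_mx X /\ symmetric_mx Y, symmetric_mx X /\ symmetric_mx Z
      | symmetric_mx Y /\ symmetric_mx Z] ->
  contains_upto A X Y Z <-> contains A (block_diag3 X Y Z).
Proof.
move=> sA sXYZ; split; last by exists false, false, false.
case=> e1 [e2 [e3]].
have [e ->] : exists e, block_diag3 (trb e1 X) (trb e2 Y) (trb e3 Z)
                        = trb e (block_diag3 X Y Z).
  case: sXYZ => -[s s']; rewrite ?(trb_sym _ s) ?(trb_sym _ s').
  - by exists e3; case: e3 => //=; rewrite tr_block_diag3 (eqP s) (eqP s').
  - by exists e2; case: e2 => //=; rewrite tr_block_diag3 (eqP s) (eqP s').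
  - by exists e1; case: e1 => //=; rewrite tr_block_diag3 (eqP s) (eqP s').
by case: e => //=; rewrite -{1}(eqP sA) contains_tr.
Qed.

(** From right to left, the outer blocks are provided by active cells of the
    middle one, hence the assumption that the latter is not empty. *)
Lemma contains_uptoP n n1 n2 n3 (A : 'M[int]_n)
    (X : 'M[int]_n1) (Y : 'M[int]_n2) (Z : 'M[int]_n3) :
    (0 < n2)%N -> signed_perm_mx A ->
    signed_perm_mx X -> signed_perm_mx Y -> signed_perm_mx Z ->
  contains_upto A X Y Z <->
  exists e f g, occ A (trb e Y) f g /\ forall a b, active X Z A (f a) (g b).
Proof.
case: n2 Y => // n2 Y _ hA hX hY hZ; split.
  case=> e1 [e2 [e3 /containsP[f [g o]]]].
  have /and3P[fi gi _] := o.
  have [o1 /occ_block_inv[o2 o3]] := occ_block_inv o.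
  exists e2, (lpart (rpart f)), (lpart (rpart g)); split=> // a b.
  apply/andP; split; apply/dominatedP.
    exists (lpart f), (lpart g), e1.
    by split=> // c; rewrite /before [lpart (rpart _) _]ffunE lpart_lt_rpart.
  exists (rpart (rpart f)), (rpart (rpart g)), e3.
  by split=> // c; rewrite /after lpart_lt_rpart ?rpart_inc.
case=> e2 [f2 [g2 [o2 act]]].
(* The outer occurrences are those given by the two extreme corners of the
   middle one: a single choice then works for all of its cells. *)
have /andP[/dominatedP[f1 [g1 [e1 [o1 f1b g1b]]]] _] := act ord0 ord0.
have /andP[_ /dominatedP[f3 [g3 [e3 [o3 f3b g3b]]]]] := act ord_max ord_max.
have /and3P[f2i g2i _] := o2.
have f12 a b : (f1 a < f2 b)%N.
  by apply: leq_trans (f1b a) _; apply: strictly_increasing_le.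
have g12 a b : (g1 a < g2 b)%N.
  by apply: leq_trans (g1b a) _; apply: strictly_increasing_le.
have f23 a b : (f2 a < f3 b)%N.
  by apply: leq_ltn_trans (f3b b); apply/strictly_increasing_le/leq_ord.
have g23 a b : (g2 a < g3 b)%N.
  by apply: leq_ltn_trans (g3b b); apply/strictly_increasing_le/leq_ord.
exists e1, e2, e3; apply/containsP.
have nz e p (M : 'M[int]_p) : signed_perm_mx M ->
    forall i, exists j, trb e M i j != 0.
  by move=> hM i; apply/signed_perm_row_neq0/signed_perm_trb.
exists (cat_ffun f1 (cat_ffun f2 f3)), (cat_ffun g1 (cat_ffun g2 g3)).
apply: occ_block o1 _ _ _ => //; first exact: nz.
- by apply: block_rows_neq0; apply: nz.
- by apply: occ_block o2 o3 _ _ => //; apply: nz.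
- move=> a y; case: (split_ordP y) => b ->; rewrite (cat_ffunl, cat_ffunr) //.
  exact: ltn_trans (f1b a) (f23 ord0 b).
- move=> a y; case: (split_ordP y) => b ->; rewrite (cat_ffunl, cat_ffunr) //.
  exact: ltn_trans (g1b a) (g23 ord0 b).
Qed.

Lemma flip_contains_upto n n1 n2 n3 (A : 'M[int]_n)
    (X : 'M[int]_n1) (Y : 'M[int]_n2) (Z : 'M[int]_n3) :
    (0 < n2)%N -> signed_perm_mx A ->
    signed_perm_mx X -> signed_perm_mx Y -> signed_perm_mx Z ->
  contains_upto A X Y Z -> contains_upto (flip_mx X Z A) X (- Y) Z.
Proof.
move=> n2_gt0 hA hX hY hZ /(contains_uptoP n2_gt0 hA hX hY hZ)[e [f [g [o act]]]].
apply/contains_uptoP; rewrite ?flip_mx_signed_perm ?signed_perm_mxN //.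
exists e, f, g; split=> [|a b]; last by rewrite active_flip.
by apply: occ_eq o => a b; rewrite trbN mxE act => ->; rewrite mxE.
Qed.

Theorem corollary3p3 (n1 n2 n3 : nat)
    (chi1 : 'M[int]_n1) (chi2 : 'M[int]_n2) (chi3 : 'M[int]_n3)
    (hchi1 : signed_perm_mx chi1) (hchi2 : signed_perm_mx chi2)
    (hchi3 : signed_perm_mx chi3)
    (hsym : [\/ symmetric_mx chi1 /\ symmetric_mx chi2,
                symmetric_mx chi1 /\ symmetric_mx chi3
              | symmetric_mx chi2 /\ symmetric_mx chi3]) :
  I_Wilf_equiv (block_diag3 chi1 chi2 chi3) (block_diag3 chi1 (- chi2) chi3).
Proof.
move=> n _; have [n2_0 | n2_gt0] := posnP n2.
  suff -> : - chi2 = chi2 by [].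
  by apply/matrixP=> i; have := ltn_ord i; rewrite {2}n2_0.
have symN (m : nat) (M : 'M[int]_m) : symmetric_mx M -> symmetric_mx (- M).
  by move/eqP=> sM; rewrite /symmetric_mx linearN /= sM.
have hsymN : [\/ symmetric_mx chi1 /\ symmetric_mx (- chi2),
    symmetric_mx chi1 /\ symmetric_mx chi3
  | symmetric_mx (- chi2) /\ symmetric_mx chi3].
  case: hsym => -[s s']; [apply: Or31 | apply: Or32 | apply: Or33];
    by split=> //; apply: symN.
have hchi2N := signed_perm_mxN hchi2.
pose F : sperm n -> sperm n := flip_sperm chi1 chi3.
have -> : SI_avoid n (block_diag3 chi1 chi2 chi3)
          = F @^-1: SI_avoid n (block_diag3 chi1 (- chi2) chi3).
  apply/setP=> A; rewrite [RHS]inE [LHS]inE [RHS]inE /F flip_sperm_SI.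
  have [AS /= | //] := boolP (A \in SI n).
  have sA : symmetric_mx A by move: AS; rewrite inE.
  have sFA := flip_mx_sym chi1 chi3 sA.
  congr (~~ _); apply/idP/idP.
    move/(contains_uptoE sA hsym)/(flip_contains_upto n2_gt0 (sperm_mxP A)).
    by move=> H; apply/(contains_uptoE sFA hsymN)/H.
  move/(contains_uptoE sFA hsymN).
  move/(flip_contains_upto n2_gt0 (flip_mx_signed_perm _ _ (sperm_mxP A))).
  by rewrite flip_mxK opprK => H; apply/(contains_uptoE sA hsym)/H.
exact/card_preimset/inv_inj/flip_spermK.
Qed.
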